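(* Let $\mathbb K$ be a field and let $\mathcal A=A(E,R)$ be a homogeneous algebra of degree $N\ge 3$ over $\mathbb K$. Let $p,r$ be integers with $0\le r\le N-2$ and $r+1\le p\le N-1$. Assume that $(p,r)$ is distinct from $(N-1,0)$ and that the complex $C_{p,r}$ is exact at degree $i=1$. Then $R=0$ or $R=E^{\otimes N}$.
   Context: $\otimes$ is the tensor product over $\mathbb K$. A homogeneous algebra of degree $N$ is $\mathcal A=A(E,R)=T(E)/(R)$, with $E$ a finite-dimensional $\mathbb K$-vector space, $R\subset E^{\otimes N}$ a linear subspace, and $(R)$ the two-sided ideal of the tensor algebra $T(E)$ generated by $R$. Its dual is $\mathcal A^!=A(E^*,R^\perp)$, where $R^\perp\subset(E^{\otimes N})^*=E^{*\otimes N}$ is the annihilator of $R$. The dual spaces of the homogeneous components of $\mathcal A^!$ are identified with subspaces of tensor powers of $E$: $(\mathcal A^!_n)^*=E^{\otimes n}$ for $n<N$, and $(\mathcal A^!_n)^*=\bigcap_{r+s=n-N}E^{\otimes r}\otimes R\otimes E^{\otimes s}$ for $n\ge N$. The chain $N$-complex $K(\mathcal A)$ is $\oplus_m\mathcal A\otimes(\mathcal A^!_m)^*$ with $\mathcal A$-linear $N$-differential $d:\mathcal A\otimes(\mathcal A^!_m)^*\to\mathcal A\otimes(\mathcal A^!_{m-1})^*$ induced by $a\otimes(e_1\otimes e_2\otimes\cdots\otimes e_m)\mapsto ae_1\otimes(e_2\otimes\cdots\otimes e_m)$ (with $d=0$ for $m=0$); one has $d^N=0$. For $0\le r\le N-2$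 and $r+1\le p\le N-1$, $C_{p,r}$ is the ordinary complex obtained from $K(\mathcal A)$ by contraction: $$\cdots\xrightarrow{d^{N-p}}\mathcal A\otimes(\mathcal A^!_{N+r})^*\xrightarrow{d^{p}}\mathcal A\otimes(\mathcal A^!_{N-p+r})^*\xrightarrow{d^{N-p}}\mathcal A\otimes(\mathcal A^!_{r})^*\xrightarrow{d^p}0.$$ The space of $C_{p,r}$ at degree $i$ is $\mathcal A\otimes(\mathcal A^!_k)^*$ with $k=jN+r$ if $i=2j$ and $k=(j+1)N-p+r$ if $i=2j+1$ ($j\in\mathbb N$). *)

(* Defs.v *)
From HB Require Import structures.
From mathcomp Require Import all_boot all_order all_algebra generic_quotient.
From mathcomp Require Import finmap boolp classical_sets.
From mathcomp.multinomials Require Import monalg.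

Set Implicit Arguments.
Unset Strict Implicit.
Unset Printing Implicit Defensive.

Import GRing.Theory.

Local Open Scope ring_scope.
Local Open Scope quotient_scope.
Local Open Scope classical_set_scope.

Section Subspaces.
Context (K : fieldType) (V : lmodType K).

Definition is_subspace (S : set V) : Prop :=
  S 0 /\ forall (c : K) (x y : V), S x -> S y -> S (c *: x + y).

Definition lin_span (S : set V) : set V := smallest is_subspace S.

End Subspaces.

(* T(E) is realized as the free associative algebra on the basis             *)
(* [vbasis {:E}] of E: the word i_1 .. i_n stands for the tensor             *)
(* e_(i_1) (x) .. (x) e_(i_n), and the product is the tensor product.        *)
(* Lemma [tensor_alg_universal] gives its universal property.                *)
Notation word E := {fmonom 'I_(\dim {:E})}.
Notation tensor_alg K E := {malg K[word E]}.

Section TensorAlgebra.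
Context (K : fieldType) (E : vectType K).
Local Notation T := (tensor_alg K E).
Implicit Types (R I : set T) (s t n : nat).

Definition letter (i : 'I_(\dim {:E})) : T := << fmu i >>.

Definition tvec (e : E) : T := \sum_i coord (vbasis {:E}) i e *: letter i.

(* E^{(x) n} *)
Definition tpow n : set T :=
  lin_span [set x | exists e : 'I_n -> E, x = \prod_(j < n) tvec (e j)].

(* E^{(x) s} (x) R (x) E^{(x) t} *)
Definition tpow_sandwich R s t : set T :=
  lin_span [set z | exists x y w,
    [/\ tpow s x, R y, tpow t w & z = x * y * w]].

Definition is_ideal I : Prop :=
  [/\ I 0, forall x y, I x -> I y -> I (x + y),
      forall a x, I x -> I (a * x) & forall a x, I x -> I (x * a)].

Definition gen_ideal R : set T := smallest is_ideal R.

(* T(E) is only declared as a left algebra in the library. *)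
Lemma tensor_scalerAr (c : K) (x y : T) : c *: (x * y) = x * (c *: y).
Proof.
rewrite malgME (malgMEw (fsubset_refl _) (msuppZ_le c y)) scaler_sumr.
apply: eq_bigr => k _; rewrite scaler_sumr; apply: eq_bigr => l _.
by apply/malgP => w; rewrite mcoeffZ !mcoeffU mcoeffZ mulrnAr mulrCA.
Qed.

Lemma tvec_linear : linear tvec.
Proof.
move=> c u v; rewrite /tvec scaler_sumr -big_split /=.
by apply: eq_bigr => i _; rewrite linearP scalerDl scalerA.
Qed.

Lemma tvec_basis (i : 'I_(\dim {:E})) : tvec (vbasis {:E})`_i = letter i.
Proof.
have /basis_free Fb := vbasisP {:E}.
rewrite /tvec (bigD1 i) //= coord_free // eqxx scale1r big1 ?addr0 // => j ji.
by rewrite coord_free // eq_sym (negbTE ji) scale0r.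
Qed.

Lemma word_prod (w : word E) : << w >> = \prod_(i <- w) letter i :> T.
Proof.
case: w => w; elim: w => [|i w IHw].
  by rewrite big_nil; congr << _ *g _ >>; apply/eqP; rewrite fmP fm1.
rewrite big_cons /= -IHw malgM_def fgmulUU mulr1 /letter.
by congr << _ *g _ >>; apply/eqP; rewrite fmP fmM fmU.
Qed.

Lemma tensor_alg_universal (B : algType K) (f : {linear E -> B}) :
  exists phi : T -> B,
    [/\ linear phi, monoid_morphism phi, phi \o tvec =1 f &
        forall psi : T -> B, linear psi -> monoid_morphism psi ->
          psi \o tvec =1 f -> psi =1 phi].
Proof.
pose h (w : word E) : B := \prod_(i <- (w : seq _)) f (vbasis {:E})`_i.
pose phi (x : T) : B := \sum_(w <- msupp x) x@_w *: h w.
have phiEw (d : {fset word E}) x : (msupp x `<=` d)%fset ->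
    phi x = \sum_(w <- d) x@_w *: h w.
  move=> le; rewrite [LHS](big_fset_incl _ le) => //= w _ /mcoeff_outdom ->.
  by rewrite scale0r.
have phi_lin : linear phi.
  move=> c x y; pose d := (msupp x `|` msupp y `|` msupp (c *: x + y))%fset.
  rewrite !(phiEw d) /d;
    try by apply/fsubsetP => w; rewrite !inE => ->; rewrite ?orbT.
  rewrite scaler_sumr -big_split /=; apply: eq_bigr => w _.
  by rewrite mcoeffD mcoeffZ scalerDl scalerA.
have linD (g : T -> B) : linear g -> {morph g : x y / x + y}.
    by move=> gl x y; rewrite -[x]scale1r gl !scale1r.
have lin0 (g : T -> B) : linear g -> g 0 = 0.
    by move=> gl; apply: (addIr (g 0)); rewrite -linD // !add0r.
have linZ (g : T -> B) : linear g -> forall c x, g (c *: x) = c *: g x.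
    by move=> gl c x; rewrite -[c *: x]addr0 gl lin0 // addr0.
have phi_sum := big_morph phi (linD _ phi_lin) (lin0 _ phi_lin).
have phiU c w : phi << c *g w >> = c *: h w.
  by rewrite (phiEw [fset w]%fset) ?msuppU_le // big_seq_fset1 mcoeffUU.
have phi1 : phi 1 = 1 by rewrite phiU /h fm1 big_nil scale1r.
have phiM : {morph phi : x y / x * y}.
  move=> x y; rewrite malgME phi_sum {2}/phi mulr_suml /=.
  apply: eq_bigr => v _; rewrite phi_sum {2}/phi mulr_sumr /=.
  apply: eq_bigr => w _; rewrite phiU -scalerAl -scalerAr scalerA.
  by rewrite /h fmM big_cat.
have phi_letter i : phi (letter i) = f (vbasis {:E})`_i.
  by rewrite phiU /h fmU big_seq1 scale1r.
exists phi; split=> // [e|psi psi_lin [psi1 psiM] psiE x] /=.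
  rewrite /tvec phi_sum [in RHS](coord_vbasis (memvf e)).
  rewrite linear_sum; apply: eq_bigr => i _.
  by rewrite linearZ linZ //= phi_letter.
rewrite [x in LHS]monalgE (big_morph psi (linD _ psi_lin) (lin0 _ psi_lin)).
apply: eq_bigr => w _ /=.
have -> : << x@_w *g w >> = x@_w *: << w >> :> T.
  by apply/malgP => v; rewrite mcoeffZ !mcoeffU mulr_natr.
rewrite linZ // word_prod; congr (_ *: _).
rewrite (big_morph psi psiM psi1); apply: eq_bigr => i _.
by rewrite -tvec_basis -psiE.
Qed.

Lemma gen_ideal_is_ideal R : is_ideal (gen_ideal R).
Proof.
split=> [I [[I0 _ _ _] _] //|x y Ix Iy I IR|a x Ix I IR|a x Ix I IR].
- by case: (IR) => -[_ + _ _] _; apply; [apply: Ix|apply: Iy].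
- by case: (IR) => -[_ _ + _] _; apply; apply: Ix.
- by case: (IR) => -[_ _ _ +] _; apply; apply: Ix.
Qed.

End TensorAlgebra.

Section HomogeneousAlgebra.
Context (K : fieldType) (E : vectType K) (R : set (tensor_alg K E)).
Local Notation T := (tensor_alg K E).

Definition gen_ideal_pred : {pred T} := fun x => `[< gen_ideal R x >].

Lemma gen_ideal_predP x : reflect (gen_ideal R x) (x \in gen_ideal_pred).
Proof. exact: asboolP. Qed.

Lemma gen_ideal_zmod_closed : zmod_closed gen_ideal_pred.
Proof.
have [I0 ID Il _] := gen_ideal_is_ideal R.
split=> [|x y /gen_ideal_predP Ix /gen_ideal_predP Iy]; apply/gen_ideal_predP.
  exact: I0.
by apply: ID => //; rewrite -mulN1r; apply: Il.
Qed.

HB.instance Definition _ :=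
  GRing.isZmodClosed.Build T gen_ideal_pred gen_ideal_zmod_closed.

(* A(E, R) = T(E) / (R).  It is only a [pzRingType] because (R) may be all   *)
(* of T(E) when R is arbitrary.                                              *)
Definition homalg : Type := Quotient.quot gen_ideal_pred.
HB.instance Definition _ := GRing.Zmodule.on homalg.

Definition homalg_pi (x : T) : homalg := \pi_(Quotient.quot gen_ideal_pred) x.

Lemma homalg_pi_eq x y : homalg_pi x = homalg_pi y <-> gen_ideal R (x - y).
Proof.
split=> [/eqP|Ixy]; last apply/eqP.
  by rewrite -Quotient.idealrBE => /gen_ideal_predP.
by rewrite -Quotient.idealrBE; apply/gen_ideal_predP.
Qed.

Lemma homalg_piK (a : homalg) : homalg_pi (repr a) = a.
Proof. exact: reprK. Qed.

Lemma homalg_piB : {morph homalg_pi : x y / x - y}.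
Proof. by move=> x y; rewrite /homalg_pi !piE. Qed.

HB.instance Definition _ :=
  GRing.isZmodMorphism.Build T homalg homalg_pi homalg_piB.

Definition homalg_one : homalg := homalg_pi 1.
Definition homalg_mul (a b : homalg) : homalg := homalg_pi (repr a * repr b).
Definition homalg_scale (c : K) (a : homalg) : homalg :=
  homalg_pi (c *: repr a).

Let homalg_mulE x y :
  homalg_mul (homalg_pi x) (homalg_pi y) = homalg_pi (x * y).
Proof.
have [_ ID Il Ir] := gen_ideal_is_ideal R.
set x' := repr (homalg_pi x); set y' := repr (homalg_pi y).
have Ix : gen_ideal R (x' - x) by apply/homalg_pi_eq/homalg_piK.
have Iy : gen_ideal R (y' - y) by apply/homalg_pi_eq/homalg_piK.
apply/homalg_pi_eq; rewrite -/x' -/y'.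
have -> : x' * y' - x * y = x' * (y' - y) + (x' - x) * y.
  by rewrite mulrBr mulrBl addrA subrK.
by apply: ID; [apply: Il|apply: Ir].
Qed.

Let homalg_scaleE c x : homalg_scale c (homalg_pi x) = homalg_pi (c *: x).
Proof.
have [_ _ Il _] := gen_ideal_is_ideal R.
apply/homalg_pi_eq; rewrite -scalerBr -mul_malgC; apply: Il.
exact/homalg_pi_eq/homalg_piK.
Qed.

Let homalg_mulA : associative homalg_mul.
Proof.
move=> a b c; rewrite -[a]homalg_piK -[b]homalg_piK -[c]homalg_piK.
by rewrite !homalg_mulE mulrA.
Qed.

Let homalg_mul1r : left_id homalg_one homalg_mul.
Proof. by move=> a; rewrite -[a]homalg_piK homalg_mulE mul1r. Qed.

Let homalg_mulr1 : right_id homalg_one homalg_mul.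
Proof. by move=> a; rewrite -[a]homalg_piK homalg_mulE mulr1. Qed.

Let homalg_mulDl : left_distributive homalg_mul +%R.
Proof.
move=> a b c; rewrite -[a]homalg_piK -[b]homalg_piK -[c]homalg_piK.
by rewrite -raddfD !homalg_mulE mulrDl raddfD.
Qed.

Let homalg_mulDr : right_distributive homalg_mul +%R.
Proof.
move=> a b c; rewrite -[a]homalg_piK -[b]homalg_piK -[c]homalg_piK.
by rewrite -raddfD !homalg_mulE mulrDr raddfD.
Qed.

HB.instance Definition _ := GRing.Zmodule_isPzRing.Build homalg
  homalg_mulA homalg_mul1r homalg_mulr1 homalg_mulDl homalg_mulDr.

Let homalg_scaleA c d a :
  homalg_scale c (homalg_scale d a) = homalg_scale (c * d) a.
Proof. by rewrite -[a]homalg_piK !homalg_scaleE scalerA. Qed.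

Let homalg_scale1 : left_id 1 homalg_scale.
Proof. by move=> a; rewrite -[a]homalg_piK homalg_scaleE scale1r. Qed.

Let homalg_scaleDr : right_distributive homalg_scale +%R.
Proof.
move=> c a b; rewrite -[a]homalg_piK -[b]homalg_piK.
by rewrite -raddfD !homalg_scaleE scalerDr raddfD.
Qed.

Let homalg_scaleDl a : {morph homalg_scale^~ a : c d / c + d}.
Proof.
by move=> c d; rewrite -[a]homalg_piK !homalg_scaleE scalerDl raddfD.
Qed.

HB.instance Definition _ := GRing.Zmodule_isLmodule.Build K homalg
  homalg_scaleA homalg_scale1 homalg_scaleDr homalg_scaleDl.

Lemma homalg_pi1 : homalg_pi 1 = 1.
Proof. by []. Qed.

Lemma homalg_piM x y : homalg_pi (x * y) = homalg_pi x * homalg_pi y.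
Proof. by rewrite -homalg_mulE. Qed.

Lemma homalg_piZ c x : homalg_pi (c *: x) = c *: homalg_pi x.
Proof. by rewrite -homalg_scaleE. Qed.

Lemma homalg_scalerAl c (a b : homalg) : c *: (a * b) = (c *: a) * b.
Proof.
rewrite -[a]homalg_piK -[b]homalg_piK.
by rewrite -homalg_piM -!homalg_piZ -homalg_piM scalerAl.
Qed.

Lemma homalg_scalerAr c (a b : homalg) : c *: (a * b) = a * (c *: b).
Proof.
rewrite -[a]homalg_piK -[b]homalg_piK.
by rewrite -homalg_piM -!homalg_piZ -homalg_piM tensor_scalerAr.
Qed.

End HomogeneousAlgebra.

Section KoszulComplex.
Context (K : fieldType) (E : vectType K) (R : set (tensor_alg K E)) (N : nat).
Local Notation T := (tensor_alg K E).
Local Notation A := (homalg R).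
Implicit Types (m n p r i : nat) (S : set T).

(* The dual of the component A^!_m of A^! = A(E^*, R^perp), identified with  *)
(* a subspace of E^{(x) m}                                                   *)
Definition dual_comp m : set T :=
  if (m < N)%N then tpow m
  else [set x | forall s t, (s + t = m - N)%N -> tpow_sandwich R s t x].

(* A (x) T(E): finitely supported families of elements of A indexed by the   *)
(* basis of words of T(E)                                                    *)
Notation AT := {malg A[word E]}.

Definition tens (a : A) (x : T) : AT :=
  \sum_(w <- msupp x) << x@_w *: a *g w >>.

(* A (x) S for a subspace S of T(E); K being a field, it is identified with  *)
(* its image in A (x) T(E).                                                  *)
Definition tens_space S : set AT :=
  [set z | exists n (a : 'I_n -> A) (x : 'I_n -> T),
    (forall j, S (x j)) /\ z = \sum_(j < n) tens (a j) (x j)].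

Definition koszul_space m : set AT := tens_space (dual_comp m).

(* The basis-free formula for the differential is [koszul_d_tens].           *)
Definition koszul_d_word (a : A) (w : word E) : AT :=
  if w : seq _ is i :: w' then << a * homalg_pi R (letter i) *g FMonom w' >>
  else 0.

Definition koszul_d (z : AT) : AT :=
  \sum_(w <- msupp z) koszul_d_word z@_w w.

Lemma mcoeff_tens a x w : (tens a x)@_w = x@_w *: a.
Proof.
rewrite raddf_sum /=; case: (msuppP x w) => [wx|wx].
  rewrite (big_fsetD1 w) //= mcoeffUU big_seq big1 ?addr0 // => v.
  by rewrite !inE => /andP[/negbTE vw _]; rewrite mcoeffU vw mulr0n.
rewrite big_seq big1 ?scale0r // => v vx; rewrite mcoeffU.
by case: eqP wx => // <-; rewrite vx.
Qed.

Lemma koszul_dEw (d : {fset word E}) z : (msupp z `<=` d)%fset ->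
  koszul_d z = \sum_(w <- d) koszul_d_word z@_w w.
Proof.
move=> le; rewrite [LHS](big_fset_incl _ le) => //= w _ /mcoeff_outdom ->.
rewrite /koszul_d_word; case: (fmonom_val w) => [|i v] //.
by rewrite mul0r monalgU0.
Qed.

Lemma koszul_dB : zmod_morphism koszul_d.
Proof.
move=> y z; pose d := (msupp y `|` msupp z `|` msupp (y - z))%fset.
rewrite !(koszul_dEw (d := d)) /d;
  try by apply/fsubsetP => w; rewrite !inE => ->; rewrite ?orbT.
rewrite -sumrB; apply: eq_bigr => -[[|i w]] _; rewrite /koszul_d_word /=.
  by rewrite subr0.
by rewrite mcoeffB mulrBl monalgUB.
Qed.

HB.instance Definition _ := GRing.isZmodMorphism.Build AT AT koszul_d koszul_dB.

Lemma koszul_d_tens1 a : koszul_d (tens a 1) = 0.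
Proof.
rewrite (koszul_dEw (d := [fset FMonom [::]]%fset)) ?big_seq_fset1 //.
apply/fsubsetP => w; rewrite -mcoeff_neq0 mcoeff_tens mcoeff1 inE !fmP fm1.
by case: (_ == [::] :> seq _); rewrite /= ?mulr0n ?scale0r ?eqxx.
Qed.

Lemma mcoeff_koszul_d z (w : word E) : (koszul_d z)@_w =
  \sum_i z@_(FMonom (i :: (w : seq _))) * homalg_pi R (letter i).
Proof.
rewrite [z in LHS]monalgE [z in RHS]monalgE (raddf_sum koszul_d) raddf_sum /=.
under [RHS]eq_bigr do rewrite raddf_sum mulr_suml.
rewrite exchange_big /=; apply: eq_bigr => v _.
rewrite (koszul_dEw msuppU_le) big_seq_fset1 mcoeffUU.
under eq_bigr do rewrite mcoeffU fmP.
move: (z@_v) => a; case: v w => -[|i v] [w] /=.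
  by rewrite mcoeff0 big1 // => i _; rewrite mul0r.
rewrite mcoeffU fmP (bigD1 i) //= eqseq_cons eqxx /= mulrnAl.
rewrite big1 ?addr0 // => j /negbTE ji.
by rewrite eqseq_cons eq_sym ji mul0r.
Qed.

Lemma koszul_d_tens a e x :
  koszul_d (tens a (tvec e * x)) = tens (a * homalg_pi R (tvec e)) x.
Proof.
have coefM (i j : 'I_(\dim {:E})) (w : word E) :
    (letter i * x)@_(FMonom (j :: (w : seq _))) = x@_w *+ (i == j).
  rewrite [x in LHS]monalgE [x in RHS]monalgE mulr_sumr !raddf_sum -sumrMnl /=.
  apply: eq_bigr => v _; rewrite malgM_def fgmulUU mul1r !mcoeffU !fmP fmM fmU.
  by rewrite eqseq_cons mulrnAC -mulrnA mulnb andbC.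
apply/malgP => w; rewrite mcoeff_koszul_d mcoeff_tens.
rewrite [tvec e in RHS]/tvec raddf_sum mulr_sumr scaler_sumr /=.
apply: eq_bigr => i _; rewrite mcoeff_tens /tvec mulr_suml raddf_sum /=.
rewrite (bigD1 i) //= big1 => [|j /negbTE ji].
  rewrite addr0 -scalerAl mcoeffZ coefM eqxx homalg_piZ.
  by rewrite -homalg_scalerAr -homalg_scalerAl scalerA mulrC.
by rewrite -scalerAl mcoeffZ coefM ji mulr0.
Qed.

Definition contraction_deg p r i : nat :=
  if odd i then (i./2.+1 * N - p + r)%N else (i./2 * N + r)%N.

Definition contraction_space p r i : set AT :=
  koszul_space (contraction_deg p r i).

(* The differential from degree i to degree i - 1.  In degree 0 it is        *)
(* d^p = 0, since r < p.                                                     *)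
Definition contraction_d p i : AT -> AT :=
  iter (if odd i then N - p else p)%N koszul_d.

Definition contraction_exact_at p r i : Prop :=
  [set z | contraction_space p r i z /\ contraction_d p i z = 0]
  = contraction_d p i.+1 @` contraction_space p r i.+1.

End KoszulComplex.

(* Main.v *)
From HB Require Import structures.
Require Import Defs.
From mathcomp Require Import all_boot all_order all_algebra.
From mathcomp Require Import finmap boolp classical_sets.
From mathcomp.multinomials Require Import monalg.

Local Open Scope ring_scope.
Local Open Scope classical_set_scope.

Set Implicit Arguments.
Unset Strict Implicit.
Unset Printing Implicit Defensive.

Import GRing.Theory.

(* It suffices to prove R (x) E c E (x) R: iterating gives
   R (x) E^N c E^N (x) R, and contracting the left factor E^N with a word that
   occurs in a nonzero element of R puts every element of E^N into R.

   For y in E^(q + N - p + r) with p <= q < N, the element d^q (1 (x) y) lies in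
   A (x) E^(N - p + r).  If y vanishes in A (x) E^r, then d^(N - p) kills that
   element, so by exactness it is the image under d^p of some element of
   A_(q - p) (x) (A^!_(N + r))^*.  As A = T(E) in degree q < N, this gives
   y in E^(q - p) (x) (A^!_(N + r))^*.  For r > 0, apply it with q = p to
   y in R (x) E^r: then y is in E (x) R (x) E^(r - 1).  For r = 0, apply it with
   q = p + 1, which is < N precisely because (p, r) <> (N - 1, 0), to
   y in R (x) E: then y is in E (x) R. *)

(** * Linear spans and closure under linear combinations *)

Section Subspaces.
Context (K : fieldType) (V : lmodType K).
Implicit Types S : set V.

Lemma lin_span_min S S' : is_subspace S' -> S `<=` S' -> lin_span S `<=` S'.
Proof. by move=> S'sub SS' x; apply. Qed.

Lemma lin_span_subspace S : is_subspace (lin_span S).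
Proof.
split=> [S' [[]]//|c x y Sx Sy S' S'S].
by case: (S'S) => -[_ +] _; apply; [apply: Sx|apply: Sy].
Qed.

Lemma subspaceZ S c x : is_subspace S -> S x -> S (c *: x).
Proof. by case=> S0 SD Sx; rewrite -[_ *: _]addr0; apply: SD. Qed.

Lemma subspace_lin_comb S (I : Type) (s : seq I) (P : pred I) (c : I -> K)
    (x : I -> V) :
  is_subspace S -> (forall i, P i -> S (x i)) ->
  S (\sum_(i <- s | P i) c i *: x i).
Proof.
case=> S0 SD Sx; elim/big_rec: _ => [|i y Pi Sy]; first exact: S0.
by apply: SD => //; apply: Sx.
Qed.

End Subspaces.

(* The part of [x] lying between the prefix [u] and the suffix [v]: [x] is
   contracted with [u^*] on the left and with [v^*] on the right. *)
HB.lock Definition slice (K : fieldType) (E : vectType K)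
    (u : seq 'I_(\dim {:E})) (k : nat) (v : seq 'I_(\dim {:E}))
    (x : tensor_alg K E) : tensor_alg K E :=
  \sum_(w : k.-tuple 'I_(\dim {:E})) << x@_(FMonom (u ++ w ++ v)) *g FMonom w >>.

(** * Word coefficients in T(E): products, degrees and contractions *)

Section Coefficients.
Context (K : fieldType) (E : vectType K).
Local Notation T := (tensor_alg K E).
Local Notation I := 'I_(\dim {:E}).
Implicit Types (x y a b : T) (u v w : seq I) (n k : nat).

(** Two words contribute exactly when they concatenate to [w], and the length of the first then
    fixes the place where [w] is cut. *)
Lemma mcoeffM_cat x y w : (x * y)@_(FMonom w) =
  \sum_(i < (size w).+1) x@_(FMonom (take i w)) * y@_(FMonom (drop i w)).
Proof.
have coefE (z : T) (v : word E) : z@_v = \sum_(k <- msupp z) z@_k *+ (k == v).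
  by rewrite {1}[z]monalgE raddf_sum; apply: eq_bigr => k _; exact: mcoeffU.
rewrite mcoeffMl.
have -> : \sum_(i < (size w).+1)
    x@_(FMonom (take i w)) * y@_(FMonom (drop i w)) =
  \sum_(i < (size w).+1) \sum_(k1 <- msupp x) \sum_(k2 <- msupp y)
    x@_k1 * y@_k2 *+ ((k1 == FMonom (take i w)) && (k2 == FMonom (drop i w))).
  apply: eq_bigr => i _.
  rewrite [x@_(FMonom _)]coefE [y@_(FMonom _)]coefE mulr_suml.
  apply: eq_bigr => k1 _; rewrite mulr_sumr; apply: eq_bigr => k2 _.
  by rewrite mulrnAr mulrnAl -mulrnA mulnb andbC.
rewrite [RHS]exchange_big /=; apply: eq_bigr => k1 _.
rewrite [RHS]exchange_big /=; apply: eq_bigr => k2 _.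
rewrite fmP fmM /=.
(* A word longer than [w] is no prefix of it, so both sides vanish. Otherwise only the cut at
   [size k1] can contribute. *)
have [k1w|k1w] := leqP (size k1) (size w); last first.
  rewrite big1 => [|i _].
    by case: eqP k1w => // <-; rewrite /= size_cat ltnNge leq_addr.
  rewrite fmP /=; case: eqP k1w => // ->.
  by rewrite size_take_min ltnNge geq_minr.
rewrite (bigD1 (Ordinal (k1w : size k1 < (size w).+1)%N)) //= big1 => [|i ni].
  rewrite addr0; congr (_ *+ _); congr nat_of_bool; rewrite !fmP /=.
  apply/eqP/andP => [<-|[/eqP e1 /eqP e2]].
    by rewrite take_size_cat // drop_size_cat // !eqxx.
  by rewrite e2 [X in X ++ _]e1 cat_take_drop.
rewrite fmP; case: eqP => //= e; case/eqP: ni; apply/val_inj => /=.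
by rewrite e size_takel // -ltnS.
Qed.

Lemma mcoeff_scaleD c x y w :
  (c *: x + y)@_(FMonom w) = c * x@_(FMonom w) + y@_(FMonom w).
Proof. by rewrite mcoeffD mcoeffZ. Qed.

(** Coefficientwise description of $E^{\otimes n}$; the agreement with [tpow n] is [tpowE]. *)
Definition homog n x := forall w, size w <> n -> x@_(FMonom w) = 0.

(** Among all cuts of [u ++ w], only the one after [n] letters meets the support of [x]. *)
Lemma mcoeffM_homogl n x y u w : homog n x -> size u = n ->
  (x * y)@_(FMonom (u ++ w)) = x@_(FMonom u) * y@_(FMonom w).
Proof.
move=> hx un; rewrite mcoeffM_cat.
have lt : (size u < (size (u ++ w)).+1)%N by rewrite size_cat ltnS leq_addr.
rewrite (bigD1 (Ordinal lt)) //= take_size_cat // drop_size_cat //.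
rewrite big1 ?addr0 // => i ni; rewrite hx ?mul0r // => e.
case/eqP: ni; apply/val_inj => /=.
by rewrite un -e size_takel // -ltnS.
Qed.

Lemma mcoeffM_homogr n x y u w : homog n y -> size w = n ->
  (x * y)@_(FMonom (u ++ w)) = x@_(FMonom u) * y@_(FMonom w).
Proof.
move=> hy wn; rewrite mcoeffM_cat.
have lt : (size u < (size (u ++ w)).+1)%N by rewrite size_cat ltnS leq_addr.
rewrite (bigD1 (Ordinal lt)) //= take_size_cat // drop_size_cat //.
rewrite big1 ?addr0 // => i ni; rewrite [y@_ _]hy ?mulr0 // => e.
case/eqP: ni; apply/val_inj => /=.
move: e (ltn_ord i); rewrite size_drop ltnS; move: (nat_of_ord i) => j.
rewrite size_cat wn => e le; apply: (@addIn n).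
by rewrite -[X in (_ + X)%N = _]e subnKC.
Qed.

Lemma homogM m n x y : homog m x -> homog n y -> homog (m + n) (x * y).
Proof.
move=> hx hy w nw; rewrite mcoeffM_cat big1 // => i _.
have [im|im] := eqVneq (size (take i w)) m; last first.
  by rewrite hx ?mul0r //; apply/eqP.
rewrite [y@_ _]hy ?mulr0 // => jn; apply: nw.
by rewrite -im -jn -size_cat cat_take_drop.
Qed.

Lemma homog_subspace n : is_subspace (homog n).
Proof.
split=> [w _|c x y hx hy w nw]; first by rewrite mcoeff0.
by rewrite mcoeff_scaleD hx // hy // mulr0 addr0.
Qed.

Lemma homog_word w : homog (size w) << FMonom w >>.
Proof.
move=> v nv; rewrite mcoeffU fmP /=.
by case: eqP nv => // ->.
Qed.

Lemma homog_tvec (e : E) : homog 1 (tvec e).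
Proof.
apply: subspace_lin_comb (homog_subspace 1) _ => i _.
by rewrite /letter fmuE; apply: (@homog_word [:: i]).
Qed.

Lemma malgUZ c w : << c *g FMonom w >> = c *: << FMonom w >> :> T.
Proof. by apply/malgP => v; rewrite mcoeffZ !mcoeffU mulr_natr. Qed.

Lemma homog_sub_subspace n (S : set T) : is_subspace S ->
  (forall w, size w = n -> S << FMonom w >>) -> homog n `<=` S.
Proof.
move=> Ssub Sw x hx.
have -> : x = \sum_(w <- msupp x | size w == n) x@_w *: << w >>.
  rewrite [LHS]monalgE [RHS]big_mkcond /=; apply: eq_bigr => -[w] _ /=.
  case: eqP => [_|nw]; first exact: malgUZ.
  by rewrite hx // monalgU0.
by apply: subspace_lin_comb Ssub _ => -[w] /eqP wn; apply: Sw.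
Qed.

(** A product of [n] vectors has degree [n]; conversely a word of length [n] is a product of [n]
    basis vectors, and such words span [homog n]. *)
Lemma tpowE n : tpow n = homog n.
Proof.
apply/seteqP; split.
  apply: lin_span_min (homog_subspace n) _ => _ [e ->].
  elim: n e => [|n IHn] e.
    by rewrite big_ord0 => w nw; rewrite mcoeff1 fmP fm1; case: w nw.
  rewrite big_ord_recl; apply: (homogM (homog_tvec _)).
  exact: (IHn (fun j => e (lift ord0 j))).
apply: homog_sub_subspace (lin_span_subspace _) _ => w <- S [_]; apply.
exists (fun j => (vbasis {:E})`_(tnth (in_tuple w) j)).
rewrite word_prod big_tnth; apply: eq_bigr => j _.
by rewrite tvec_basis.
Qed.

Lemma mcoeff_slice u k v x w : (slice u k v x)@_(FMonom w) =
  if size w == k then x@_(FMonom (u ++ w ++ v)) else 0.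
Proof.
rewrite slice.unlock raddf_sum /=; case: eqP => [<-|nw].
  rewrite (bigD1 (in_tuple w)) //= mcoeffUU big1 ?addr0 // => t nt.
  rewrite mcoeffU fmP /=; case: eqP => // e.
  by case/eqP: nt; apply/val_inj.
rewrite big1 // => t _; rewrite mcoeffU fmP /=; case: eqP => // e.
by case: nw; rewrite -e size_tuple.
Qed.

Lemma homog_slice u k v x : homog k (slice u k v x).
Proof. by move=> w /eqP/negbTE nw; rewrite mcoeff_slice nw. Qed.

Lemma slice_linear u k v : linear (slice u k v).
Proof.
move=> c x y; apply/malgP => -[w]; rewrite mcoeff_scaleD !mcoeff_slice.
by case: eqP => _; rewrite ?mcoeff_scaleD // mulr0 addr0.
Qed.

Lemma slice_subspace u k v (S : set T) :
  is_subspace S -> is_subspace [set x | S (slice u k v x)].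
Proof.
case=> S0 SD; split=> [|c x y Sx Sy] /=; last by rewrite slice_linear; apply: SD.
suff -> : slice u k v 0 = 0 by [].
by rewrite slice.unlock big1 // => w _; rewrite mcoeff0 monalgU0.
Qed.

Lemma slice_id k x : homog k x -> slice [::] k [::] x = x.
Proof.
move=> hx; apply/malgP => -[w]; rewrite mcoeff_slice /= cats0.
by case: eqP => // nw; rewrite hx.
Qed.

Lemma slice_mid u k v a y b : homog (size u) a -> homog k y ->
    homog (size v) b ->
  slice u k v (a * y * b) = (a@_(FMonom u) * b@_(FMonom v)) *: y.
Proof.
move=> ha hy hb; apply/malgP => -[w]; rewrite mcoeff_slice mcoeffZ.
case: eqP => [_|nw]; last by rewrite hy // mulr0.
rewrite catA (mcoeffM_homogr _ _ hb) // (mcoeffM_homogl _ _ ha) //.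
by rewrite mulrAC.
Qed.

Lemma mulUU_cat v w :
  << FMonom v >> * << FMonom w >> = << FMonom (v ++ w) >> :> T.
Proof.
rewrite malgM_def fgmulUU mulr1; congr << _ *g _ >>.
by apply/eqP; rewrite fmP fmM.
Qed.

Lemma slice_mul_word u k v x :
  slice u k v (x * << FMonom v >>) = slice u k [::] x.
Proof.
apply/malgP => -[w]; rewrite [LHS]mcoeff_slice [RHS]mcoeff_slice.
case: eqP => [_|//]; rewrite catA.
rewrite (mcoeffM_homogr _ _ (@homog_word v) (erefl : size v = _)).
by rewrite mcoeffUU mulr1 cats0.
Qed.

(** * Spaces built from the relations, and the ideal they generate *)

Context (R : set T) (N : nat).
Hypotheses (N_gt0 : (0 < N)%N) (R_subspace : is_subspace R) (R_deg : R `<=` homog N).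

(** By linearity it is enough to treat a product [a * y * b] with [y] in [R], whose contraction is a
    scalar multiple of [y]. *)
Lemma sandwich_slice u v x :
  tpow_sandwich R (size u) (size v) x -> R (slice u N v x).
Proof.
apply: (@lin_span_min _ _ _ [set x | R (slice u N v x)]).
  exact: slice_subspace.
move=> _ [a [y [b [+ Ry + ->]]]] /=; rewrite !tpowE => ha hb.
by rewrite slice_mid //; [apply: subspaceZ|apply: R_deg].
Qed.

Lemma sandwich_homog s t : tpow_sandwich R s t `<=` homog (s + N + t).
Proof.
apply: lin_span_min (homog_subspace _) _ => _ [a [y [b [+ Ry + ->]]]].
by rewrite !tpowE => ha hb; apply: homogM => //; apply: homogM => //; apply: R_deg.
Qed.

Lemma dual_comp_subspace m : is_subspace (dual_comp R N m).
Proof.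
rewrite /dual_comp; case: ifP => _; first exact: lin_span_subspace.
have sub s t : is_subspace (tpow_sandwich R s t) by exact: lin_span_subspace.
split=> [s t _|c x y Wx Wy s t st]; case: (sub s t) => // _; apply.
  exact: Wx.
exact: Wy.
Qed.

Lemma dual_comp_homog r : dual_comp R N (N + r) `<=` homog (N + r).
Proof.
rewrite /dual_comp ltnNge leq_addr /= addKn => x /(_ 0%N r (add0n r)).
by move/sandwich_homog; rewrite add0n.
Qed.

Lemma dual_comp_slice r u v x : (size u + size v)%N = r ->
  dual_comp R N (N + r) x -> R (slice u N v x).
Proof.
rewrite /dual_comp ltnNge leq_addr /= addKn => uv /(_ _ _ uv).
exact: sandwich_slice.
Qed.

(** The elements without terms of degree below [N] form an ideal containing [R]. Hence the quotient
    map loses nothing in those degrees. *)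
Lemma gen_ideal_low x w : gen_ideal R x -> (size w < N)%N -> x@_(FMonom w) = 0.
Proof.
move=> Ix wN.
suff : [set x : T | forall w, (size w < N)%N -> x@_(FMonom w) = 0] x by apply.
apply: Ix; split; last first.
  by move=> y /R_deg hy v vN; apply: hy => e; rewrite e ltnn in vN.
split=> /= [v _|y z hy hz v vN|a y hy v vN|a y hy v vN].
- by rewrite mcoeff0.
- by rewrite mcoeffD hy // hz // addr0.
- rewrite mcoeffM_cat big1 // => i _; rewrite hy ?mulr0 //.
  by rewrite size_drop (leq_ltn_trans _ vN) // leq_subr.
- rewrite mcoeffM_cat big1 // => i _; rewrite hy ?mul0r //.
  by rewrite size_take_min (leq_ltn_trans _ vN) // geq_minr.
Qed.

Lemma gen_ideal_sub x : R x -> gen_ideal R x.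
Proof. by move=> Rx J [_]; apply. Qed.

(** The hypothesis is the coordinate form of $R\otimes E\subset E\otimes R$. *)
Lemma commuting_relations :
    (forall x i j, R x -> R (slice [:: i] N [::] (x * letter j))) ->
  R = [set 0] \/ R = tpow N.
Proof.
move=> comm.
(* Iterated form $R\otimes E^{\otimes n}\subset E^{\otimes n}\otimes R$, by induction on the common
   length of [u] and [v]. *)
have commn u : forall v x, size v = size u -> R x ->
    R (slice u N [::] (x * << FMonom v >>)).
  elim/last_ind: u => [|u i IHu] v x.
    case: v => // _ Rx; rewrite -fmoneE mulr1 slice_id //; exact: R_deg.
  elim/last_ind: v => [|v j _]; rewrite !size_rcons // => -[vu] Rx.
  suff -> : slice (rcons u i) N [::] (x * << FMonom (rcons v j) >>) =
      slice [:: i] N [::] (slice u N [::] (x * << FMonom v >>) * letter j).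
    exact: comm (IHu v x vu Rx).
  apply/malgP => -[w].
  rewrite [LHS]mcoeff_slice [RHS]mcoeff_slice; case: eqP => [wN|//].
  have -> : << FMonom (rcons v j) >> = << FMonom v >> * letter j :> T.
    by rewrite /letter fmuE mulUU_cat cats1.
  (* As [N > 0], the word [w] has a last letter; it is the one paired with [letter j] on both
     sides. *)
  case/lastP: w wN => [|w l] wN; first by exfalso; move: N_gt0; rewrite -wN.
  rewrite mulrA !cats0 cat_rcons -!cats1 -cat_cons !catA /letter fmuE.
  rewrite [LHS](mcoeffM_homogr _ _ (@homog_word [:: j]) (erefl : size [:: l] = _)).
  rewrite [RHS](mcoeffM_homogr _ _ (@homog_word [:: j]) (erefl : size [:: l] = _)).
  congr (_ * _); rewrite [RHS]mcoeff_slice cats0 /=.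
  by rewrite ifT // -wN size_rcons.
have [R0|] := pselect (R `<=` [set 0]).
  left; apply/seteqP; split=> // _ ->; by case: R_subspace.
move=> /existsNP[x /not_implyP[Rx nx]]; right; rewrite tpowE.
apply/seteqP; split=> //; apply: homog_sub_subspace => // v vN.
have [u xu] : exists u, x@_(FMonom u) <> 0.
  apply/existsNP => x0; apply: nx; apply/malgP => -[w].
  by rewrite x0 mcoeff0.
have uN : size u = N.
  by case: (eqVneq (size u) N) => // /eqP nu; case: xu; apply: R_deg nu.
have {commn} := commn u v x (etrans vN (esym uN)) Rx.
(* Contracting all of [x] away leaves a nonzero multiple of the arbitrary word [v], which therefore
   lies in [R]. *)
suff -> : slice u N [::] (x * << FMonom v >>) = x@_(FMonom u) *: << FMonom v >>.
  move=> /(subspaceZ (x@_(FMonom u))^-1 R_subspace).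
  by rewrite scalerA mulVf ?scale1r //; apply/eqP.
apply/malgP => -[w]; rewrite mcoeff_slice -[_ *: _]addr0 mcoeff_scaleD mcoeff0.
rewrite cats0 addr0; case: eqP => [wN|nw].
  by rewrite (mcoeffM_homogl _ _ (R_deg Rx) uN).
by rewrite (homog_word (w := v)) ?mulr0 // vN.
Qed.

End Coefficients.

(** * Iterates of the Koszul differential in coordinates *)

Section Differential.
Context (K : fieldType) (E : vectType K) (R : set (tensor_alg K E)).
Local Notation T := (tensor_alg K E).
Local Notation A := (homalg R).
Local Notation I := 'I_(\dim {:E}).
Local Notation pi := (homalg_pi R).
Implicit Types (x y : T) (u v w : seq I).

Lemma sum_tuple_cons (V : nmodType) k (F : seq I -> V) :
  \sum_(u : k.+1.-tuple I) F u = \sum_(i : I) \sum_(u : k.-tuple I) F (i :: u).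
Proof.
rewrite pair_big /=.
rewrite (reindex (fun p : I * k.-tuple I => [tuple of p.1 :: p.2])) //=.
exists (fun u : k.+1.-tuple I => (thead u, [tuple of behead u])) => [[i u] _|u _] /=.
  by congr pair; apply/val_inj.
by rewrite [RHS]tuple_eta.
Qed.

(** Each application of [koszul_d] moves the first letter of a word into the algebra factor, so [k]
    of them move a prefix of length [k]. *)
Lemma mcoeff_iter_koszul_d k (z : {malg A[word E]}) w :
  (iter k (@koszul_d K E R) z)@_(FMonom w) =
  \sum_(u : k.-tuple I) z@_(FMonom (u ++ w)) * pi << FMonom u >>.
Proof.
elim: k z => [|k IHk] z.
  rewrite (big_pred1 [tuple]) => [|u]; last by apply/esym/eqP/tuple0.
  by rewrite /= -fmoneE homalg_pi1 mulr1.
rewrite iterSr IHk.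
rewrite (sum_tuple_cons _ (fun u => z@_(FMonom (u ++ w)) * pi << FMonom u >>)).
rewrite exchange_big /=; apply: eq_bigr => u _.
rewrite mcoeff_koszul_d mulr_suml; apply: eq_bigr => i _.
rewrite -mulrA -homalg_piM; congr (_ * homalg_pi _ _).
by rewrite /letter fmuE mulUU_cat.
Qed.

Lemma iter_koszul_d_sum k n (F : 'I_n -> {malg A[word E]}) :
  iter k (@koszul_d K E R) (\sum_j F j) =
  \sum_j iter k (@koszul_d K E R) (F j).
Proof. by elim: k => //= k ->; rewrite raddf_sum. Qed.

Lemma mcoeff_iter_koszul_d_tens k x y w :
  (iter k (@koszul_d K E R) (tens (pi x) y))@_(FMonom w) =
  pi (x * slice [::] k w y).
Proof.
rewrite mcoeff_iter_koszul_d slice.unlock mulr_sumr raddf_sum /=.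
apply: eq_bigr => u _; rewrite mcoeff_tens malgUZ -tensor_scalerAr.
by rewrite homalg_piZ homalg_piM homalg_scalerAl.
Qed.

Lemma iter_koszul_d_mem k n y : homog (k + n) y ->
  tens_space (tpow n) (iter k (@koszul_d K E R) (tens 1 y)).
Proof.
(* The decomposition is the sum over prefixes [u] of length [k] of $\pi(u)\otimes$ the contraction
   of [y] by [u]; [t] numbers the prefixes, as [tens_space] asks for an ordinal index. *)
move=> hy; pose t := enum_val (A := {: k.-tuple I}).
exists #|{: k.-tuple I}|, (fun j => pi << FMonom (t j) >>).
exists (fun j => slice (t j) n [::] y); split=> [j|].
  by rewrite tpowE; apply: homog_slice.
apply/malgP => -[w]; rewrite mcoeff_iter_koszul_d raddf_sum /=.
rewrite (reindex t) /=; last by apply: onW_bij; apply: enum_val_bij.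
apply: eq_bigr => j _; rewrite !mcoeff_tens mcoeff_slice cats0.
case: eqP => [_|nw]; first by rewrite -homalg_scalerAl mul1r.
rewrite hy ?scale0r ?mul0r // size_cat size_tuple => /addnI; exact: nw.
Qed.

End Differential.

(** * Consequences of exactness in degree 1 *)

Section Exactness.
Context (K : fieldType) (E : vectType K) (R : set (tensor_alg K E)).
Context (N p r : nat).
Local Notation T := (tensor_alg K E).
Local Notation A := (homalg R).
Local Notation I := 'I_(\dim {:E}).
Implicit Types (x y : T) (u v w : seq I).
Hypothesis R_deg : R `<=` homog N.
Hypotheses (r_lt_p : (r < p)%N) (p_lt_N : (p < N)%N).
Hypothesis exact1 : contraction_exact_at R N p r 1.

(** The condition on [w] says that [y] vanishes in $\mathcal A\otimes E^{\otimes r}$; letting [u]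
    vary, the conclusion says that [y] lies in $E^{\otimes(q-p)}\otimes(\mathcal A^!_{N+r})^*$. *)
Lemma exact_slice q y u : (p <= q < N)%N ->
    homog (q + (N - p) + r) y ->
    (forall w, size w = r -> gen_ideal R (slice [::] (q + (N - p)) w y)) ->
    size u = (q - p)%N ->
  dual_comp R N (N + r) (slice u (N + r) [::] y).
Proof.
move=> /andP[pq qN] hy Iy uE; set m := (N - p + r)%N.
pose z := iter q (@koszul_d K E R) (tens 1 y).
(* From [r < p]; this selects the branch of [dual_comp] where the degree 1 space is all of $\mathcal
   A\otimes E^{\otimes m}$. *)
have mN : (m < N)%N by rewrite /m -{2}(subnK (ltnW p_lt_N)) ltn_add2l.
have qm : (q + (N - p) + r = q + m)%N by rewrite -addnA.
have : (@contraction_d K E R N p 2 @` @contraction_space K E R N p r 2) z.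
  rewrite -exact1; split.
    rewrite /contraction_space /contraction_deg /= mul1n /koszul_space.
    rewrite /dual_comp mN; apply: iter_koszul_d_mem; rewrite -qm; exact: hy.
  rewrite /contraction_d /= /z -iterD addnC; apply/malgP => -[w].
  rewrite mcoeff0 -homalg_pi1 mcoeff_iter_koszul_d_tens mul1r.
  rewrite -[RHS](raddf0 (homalg_pi R)); apply/homalg_pi_eq; rewrite subr0.
  have [wr|/eqP nw] := eqVneq (size w) r; first exact: Iy.
  have [I0 _ _ _] := gen_ideal_is_ideal R.
  suff -> : slice [::] (q + (N - p)) w y = 0 by [].
  apply/malgP => -[v]; rewrite mcoeff_slice mcoeff0; case: eqP => // vE.
  by apply: hy; rewrite /= size_cat vE => /addnI.
case=> _ [n [a [x [Wx ->]]]].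
rewrite /contraction_d /= => dz.
have {}Wx j : dual_comp R N (N + r) (x j).
  by have := Wx j; rewrite /contraction_deg /= mul1n.
have hx j : homog (N + r) (x j) by apply: dual_comp_homog (Wx j).
(* These lifts to T(E) may be inhomogeneous; only their coefficients on words of length [q - p] are
   read off. *)
pose b j := repr (a j).
have yE v w : size v = q -> size w = m -> y@_(FMonom (v ++ w)) =
    \sum_j (b j)@_(FMonom (take (q - p) v)) *
      (x j)@_(FMonom (drop (q - p) v ++ w)).
  move=> vq wm.
  have : homalg_pi R (slice [::] q w y) =
      homalg_pi R (\sum_j b j * slice [::] p w (x j)).
    rewrite -[slice _ _ _ y]mul1r -mcoeff_iter_koszul_d_tens homalg_pi1.
    rewrite -/z -dz iter_koszul_d_sum !raddf_sum /=; apply: eq_bigr => j _.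
    by rewrite -[in LHS](homalg_piK (a j)) mcoeff_iter_koszul_d_tens.
  (* Since [v] has length [q < N], equality in the quotient gives equality of the coefficients at
     [v]. *)
  move/homalg_pi_eq/(gen_ideal_low R_deg (w := v)); rewrite vq => /(_ qN).
  move/eqP; rewrite mcoeffB subr_eq0 => /eqP.
  rewrite mcoeff_slice vq eqxx /= => ->.
  rewrite raddf_sum /=; apply: eq_bigr => j _.
  rewrite -{1}(cat_take_drop (q - p) v).
  have dv : size (drop (q - p) v) = p by rewrite size_drop vq subKn.
  rewrite (mcoeffM_homogr _ _ (@homog_slice _ _ _ _ _ _) dv).
  by rewrite mcoeff_slice dv eqxx.
have -> : slice u (N + r) [::] y = \sum_j (b j)@_(FMonom u) *: x j.
  apply/malgP => -[w]; rewrite mcoeff_slice raddf_sum /= cats0.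
  case: eqP => [wE|nw]; last first.
    rewrite big1 // => j _; rewrite -[_ *: _]addr0 mcoeff_scaleD mcoeff0 hx //.
    by rewrite mulr0 addr0.
  have pw : (p <= size w)%N by rewrite wE (leq_trans (ltnW p_lt_N)) ?leq_addr.
  (* Cutting [w] after [p] letters makes [u] and the first piece a word of length [q], and leaves
     [m] letters. *)
  rewrite -{1}(cat_take_drop p w) catA yE.
  - apply: eq_bigr => j _; rewrite take_size_cat // drop_size_cat //.
    by rewrite cat_take_drop -[_ *: _]addr0 mcoeff_scaleD mcoeff0 addr0.
  - by rewrite size_cat uE size_takel // subnK.
  - by rewrite size_drop wE -addnBAC // ltnW.
by apply: subspace_lin_comb => //; apply: dual_comp_subspace.
Qed.

End Exactness.

Theorem proposition4 (K : fieldType) (E : vectType K) (N : nat)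
    (R : set (tensor_alg K E)) (p r : nat)
    (N_ge3 : (3 <= N)%N)
    (R_subspace : is_subspace R) (R_deg : R `<=` tpow N)
    (r_le : (r <= N - 2)%N) (p_ge : (r + 1 <= p)%N) (p_le : (p <= N - 1)%N)
    (pr_neq : (p, r) <> (N - 1, 0)%N)
    (exact1 : contraction_exact_at R N p r 1) :
  R = [set 0] \/ R = tpow N.
Proof.
have N_gt0 : (0 < N)%N by apply: leq_trans N_ge3.
have r_lt_p : (r < p)%N by rewrite -addn1.
have p_lt_N : (p < N)%N by rewrite -(subnK N_gt0) addn1 ltnS.
have R_homog : R `<=` homog N by rewrite -tpowE.
have [_ _ idealMl idealMr] := gen_ideal_is_ideal R.
apply: (commuting_relations N_gt0 R_subspace R_homog) => x i j Rx.
have hx := R_homog x Rx; have Ix := gen_ideal_sub Rx.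
rewrite /letter fmuE.
case: r => [|r] in r_le p_ge pr_neq exact1 r_lt_p *.
  have pN : (p.+1 < N)%N.
    rewrite ltn_neqAle p_lt_N andbT; apply: contra_notN pr_neq => /eqP <-.
    by rewrite subn1.
  have degE : (p.+1 + (N - p) = N + 1)%N by rewrite addSn subnKC ?addn1 // ltnW.
  have hy : homog (N + 1) (x * << FMonom [:: j] >>).
    by apply: homogM hx (@homog_word _ _ [:: j]).
  have Iy w : size w = 0 ->
      gen_ideal R (slice [::] (N + 1) w (x * << FMonom [:: j] >>)).
    by move/size0nil ->; rewrite slice_id //; apply: idealMr.
  have := exact_slice R_homog r_lt_p p_lt_N exact1 (q := p.+1)
    (y := x * << FMonom [:: j] >>) (u := [:: i]).
  rewrite pN leqnSn degE !addn0 subSnn => /(_ isT hy Iy erefl).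
  (* In degree [N + 0] the only window of [N] letters is the whole word, so membership in
     [dual_comp] gives membership in [R]. *)
  rewrite -[X in dual_comp _ _ X]addn0.
  move/(dual_comp_slice R_subspace R_homog (u := [::]) (v := [::]) erefl).
  by rewrite slice_id //; apply: homog_slice.
(* Here [r] is the predecessor of the original value. The [r] further copies of [j] are padding,
   removed at the end by [slice_mul_word]. *)
have hw := @homog_word K E (j :: nseq r j).
rewrite /= size_nseq in hw.
have hy := homogM hx hw.
have Iy w : size w = r.+1 ->
    gen_ideal R (slice [::] N w (x * << FMonom (j :: nseq r j) >>)).
  move=> wr; apply: gen_ideal_sub; rewrite -[x]mul1r slice_mid ?wr //.
    exact: subspaceZ.
  by have := @homog_word K E [::]; rewrite -fmoneE.
have := exact_slice R_homog r_lt_p p_lt_N exact1 (q := p)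
  (y := x * << FMonom (j :: nseq r j) >>) (u := [::]).
rewrite p_lt_N leqnn subnKC ?(ltnW p_lt_N) // subnn.
move=> /(_ isT hy Iy erefl); rewrite slice_id //.
have uv : (size [:: i] + size (nseq r j) = r.+1)%N by rewrite size_nseq.
move/(dual_comp_slice R_subspace R_homog uv).
by rewrite -[j :: _]cat1s -mulUU_cat mulrA slice_mul_word.
Qed.
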